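(* Let $\kappa$ be an infinite cardinal with $\kappa<2^\omega$. If $C\subseteq\mathbb{R}^\infty$ has cardinality $\kappa$ and $S\subseteq\mathbb{R}$ satisfies $S\leq_{BSS} C$, then $S$ is locally of bicardinality $\leq\kappa$. The same conclusion holds if instead $C\subseteq\mathbb{R}^\infty$ has co-cardinality $\kappa$ (i.e. $|\mathbb{R}^\infty-C|=\kappa$).
   Context: BSS machines over $\mathbb{R}$: $\mathbb{R}^\infty$ is the set of finite tuples of reals. A BSS machine has a program with finitely many real constants (parameters); it can apply $+,-,\times,\div$ to cell contents, copy cells, overwrite a cell with $0$, and branch on whether a cell's content is $=0$, $<0$ or $>0$. An oracle BSS machine with oracle $B\subseteq\mathbb{R}^\infty$ may additionally branch on whether a previously computed tuple lies in $B$. $B\leq_{BSS}A$ means the characteristic function of $B$ is computed by some oracle BSS machine (with real parameters allowed) using oracle $A$. A set $S\subseteq\mathbb{R}$ is locally of bicardinality $\leq\kappa$ if there exist open sets $U,V\subseteq\mathbb{R}$ with $|\mathbb{R}-(U\cup V)|\leq\kappa$, $|U\cap S|\leq\kappa$ and $|V\cap(\mathbb{R}-S)|\leq\kappa$. *)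

(* Defs.v *)
From HB Require Import structures.
From mathcomp Require Import all_boot all_order all_algebra.
From mathcomp Require Export boolp classical_sets functions cardinality reals.
From mathcomp Require Export topology normedtype numfun.

Set Implicit Arguments.
Unset Strict Implicit.
Unset Printing Implicit Defensive.

Import Order.TTheory GRing.Theory Num.Theory.
Import numFieldNormedType.Exports.

Local Open Scope classical_set_scope.
Local Open Scope card_scope.
Local Open Scope ring_scope.

(* Oracle BSS machines over R.  The tape is two-way infinite; a cell holds a
   real or is blank (None).  There is no separate head: cell addresses are
   relative to the current position, which is always cell 0, and Shift
   translates the tape, so that unboundedly many cells can be visited although
   each instruction mentions finitely many addresses.  R^infty is seq R. *)

Inductive arith := Add | Sub | Mul | Div.

(* The parameters of a machine are the constants c of its Const
   instructions; Const k 0 overwrites cell k with 0.  The final nat arguments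
   of the branching instructions are the instruction numbers to jump to; all
   other instructions continue with the next one. *)
Inductive instr (R : Type) :=
| Const of int & R
| Op of arith & int & int & int (* Op o k i j: cell k := cell i o cell j *)
| Copy of int & int             (* Copy k i: cell k := cell i *)
| Erase of int
| Shift of int
| IfSign of int & nat & nat & nat (* content = 0, < 0, > 0 *)
| IfBlank of int & nat & nat      (* blank, not blank *)
| IfOracle of nat & nat.          (* tuple in the oracle, not in the oracle *)

Arguments Erase {R}.
Arguments Shift {R}.
Arguments Op {R}.
Arguments Copy {R}.
Arguments IfSign {R}.
Arguments IfBlank {R}.
Arguments IfOracle {R}.

Definition program (R : Type) := seq (instr R).

Section BSS.
Variable R : realType.

Definition tape := int -> option R.

(* instruction counter and tape *)
Definition config := (nat * tape)%type.

Definition write (t : tape) (k : int) (v : option R) : tape :=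
  fun i => if i == k then v else t i.

Definition input_tape (x : seq R) : tape :=
  fun i => if i is Posz n then onth x n else None.

(* y is the tuple stored in cells 0, 1, ... up to the first blank one; at most
   one y has this property, exactly one if some cell i >= 0 is blank, as is
   the case at every stage of a computation. *)
Definition tape_tuple (t : tape) (y : seq R) : Prop :=
  forall i : nat, (i <= size y)%N -> t i%:Z = onth y i.

Definition arith_eval (o : arith) (a b : R) : option R :=
  match o with
  | Add => Some (a + b)
  | Sub => Some (a - b)
  | Mul => Some (a * b)
  | Div => if b == 0 then None else Some (a / b)
  end.

(* None means that the instruction cannot be executed: division by 0, or a
   blank cell used as an operand or in a sign test.  Such a computation
   produces no output. *)
Definition exec (A : set (seq R)) (ins : instr R) (c : config)
  : option config :=
  let: (pc, t) := c in
  match ins with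
  | Const k a => Some (pc.+1, write t k (Some a))
  | Op o k i j =>
      if (t i, t j) is (Some a, Some b) then
        if arith_eval o a b is Some r then Some (pc.+1, write t k (Some r))
        else None
      else None
  | Copy k i => Some (pc.+1, write t k (t i))
  | Erase k => Some (pc.+1, write t k None)
  | Shift k => Some (pc.+1, fun i => t (i + k))
  | IfSign k l0 lneg lpos =>
      if t k is Some a then
        Some (if a == 0 then l0 else if a < 0 then lneg else lpos, t)
      else None
  | IfBlank k l1 l2 => Some (if t k is None then l1 else l2, t)
  | IfOracle l1 l2 =>
      Some (if `[< exists2 y, tape_tuple t y & A y >] then l1 else l2, t)
  end.

Definition step (P : program R) (A : set (seq R)) (c : config)
  : option config :=
  if onth P c.1 is Some ins then exec A ins c else None.

Definition run (P : program R) (A : set (seq R)) (n : nat) (c : config)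
  : option config :=
  iter n (obind (step P A)) (Some c).

(* A machine halts when the instruction counter leaves the program. *)
Definition outputs (P : program R) (A : set (seq R)) (x y : seq R) : Prop :=
  exists n pc t, [/\ run P A n (0%N, input_tape x) = Some (pc, t),
    (size P <= pc)%N & tape_tuple t y].

Definition bss_reducible (B A : set (seq R)) : Prop :=
  exists P : program R, forall x : seq R, outputs P A x [:: \1_B x].

(* A set of reals as a set of tuples of length 1. *)
Definition tuples1 (S : set R) : set (seq R) := [set [:: x] | x in S].

(* A cardinal kappa is given by a set K of cardinality kappa. *)
Definition locally_bicard_le (T : Type) (K : set T) (S : set R) : Prop :=
  exists U V : set R, open U /\ open V /\
    (~` (U `|` V) #<= K) /\ (U `&` S #<= K) /\ (V `&` ~` S #<= K).

End BSS.

(* Main.v *)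
(* Run the machine symbolically: every cell holds a rational function of the
   input [x] whose coefficients are generated by the program constants.  Call
   [x] generic if it is a root of no nonzero polynomial among the denominators
   [q] and the [p - c q], where [p / q] is such a rational function and [c] is
   a coordinate of a tuple of [C].  There are countably many [p / q], so at
   most kappa reals are not generic.  On generic inputs a sign test is locally
   constant, and a tuple on the tape lies in [C] only if all its coordinates
   are constant rational functions, in which case it does so for all generic
   inputs alike.  Hence [S] is locally constant on the generic reals.  If [N] is
   the set of non-generic reals, then the interiors of [~` S `|` N] and of
   [S `|` N] serve as [U] and [V]. *)
From mathcomp Require Import all_boot all_order all_algebra.
From mathcomp Require Import ring lra.
From mathcomp Require Import boolp classical_sets functions cardinality reals.
From mathcomp Require Import topology normedtype numfun derive.
Require Import Defs.

Set Implicit Arguments.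
Unset Strict Implicit.
Unset Printing Implicit Defensive.

Import Order.TTheory GRing.Theory Num.Theory.
Import numFieldNormedType.Exports.

Local Open Scope classical_set_scope.
Local Open Scope card_scope.
Local Open Scope ring_scope.

(** * Cardinal arithmetic: countable factors are absorbed by an infinite cardinal *)

(** Zorn's lemma gives a maximal disjoint family; an infinite remainder would contain the range of
    one more injection. The ranges serve to absorb a factor [nat] into [K]. *)
Lemma infinite_set_disjoint_injections T (K : set T) : infinite_set K ->
  exists E : set (nat -> T),
    [/\ forall f, E f -> injective f /\ range f `<=` K,
        trivIset E (fun f => range f) &
        finite_set (K `\` \bigcup_(f in E) range f)].
Proof.
elim/Ppointed: T => T in K *; first by rewrite emptyE.
move=> Kinf; pose D := [set f : nat -> T | injective f /\ range f `<=` K].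
have [E [ED tE Emax]] :=
  ex_maximal_disjoint_subcollection (fun f : nat -> T => range f) D.
exists E; split => //; apply: contrapT => /infiniteP /pcard_leP[g].
have ginj : injective g by move=> i j; apply: (@inj _ _ _ g); rewrite inE.
have gK : range g `<=` K `\` \bigcup_(f in E) range f.
  by move=> _ [i _ <-]; apply: (@funS _ _ _ _ g).
have gE : ~ E g.
  move=> Eg; have [_] : (K `\` \bigcup_(f in E) range f) (g 0%N).
    by apply: gK; exists 0%N.
  by apply; exists (g : nat -> T) => //; exists 0%N.
apply: (Emax (E `|` [set g : nat -> T])).
- by split; [exact: subsetUl|move=> EE; apply: gE; apply: EE; right].
- by move=> f [/ED //|->]; split => // x /gK [].
- move=> f h [Ef|->] [Eh|->] // [x [fx hx]].
  + by apply: (tE f h) => //; exists x.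
  + by have [_] := gK _ hx; case; exists f.
  + by have [_] := gK _ fx; case; exists h.
Qed.

Lemma inj_sub_card_le (T U : Type) (A : set T) (B : set U) (f : T -> U) :
  {in A &, injective f} -> f @` A `<=` B -> A #<= B.
Proof.
move=> finj fAB; apply: card_le_trans (subset_card_le fAB).
by move: (inj_card_eq finj); rewrite card_eq_le => /andP[].
Qed.

Lemma card_setX_nat_le T (K : set T) : infinite_set K ->
  K `*` [set: nat] #<= K.
Proof.
move=> Kinf; have [E [EK tE finG]] := infinite_set_disjoint_injections Kinf.
set G := K `\` _ in finG.
have [f0 Ef0] : E !=set0.
  apply/set0P/eqP => E0; apply: Kinf.
  by move: finG; rewrite /G E0 bigcup_set0 setD0.
have [g ginj] : exists g : T -> nat, {in G &, injective g}.
  exact/countable_injP/finite_set_countable.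
(* [K] is the disjoint union of the ranges of the injections in [E] and of the
   finite [G]; so [k] is coded by a member of [E], a tag and a number, and the
   range of that member has room for [code k] paired with any [n]. *)
pose code k (p : (nat -> T) * (bool * nat)) := E p.1 /\
  if p.2.1 then p.1 p.2.2 = k else G k /\ g k = p.2.2.
have codeP k : exists p, K k -> code k p.
  have [[f Ef [n _ fn]]|nk] := pselect ((\bigcup_(f in E) range f) k).
    by exists (f, (true, n)).
  by exists (f0, (false, g k)) => Kk; split.
have [h hP] := choice codeP.
have hinj k k' : K k -> K k' -> h k = h k' -> k = k'.
  move=> /hP ck /hP ck' hk; move: ck ck'; rewrite /code hk.
  case: (_.2.1) => -[_ + [_]].
    by move=> -> ->.
  by move=> [Gk <-] [Gk' /esym]; apply: ginj; rewrite inE.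
pose F (q : T * nat) := (h q.1).1 (pickle (q.2, (h q.1).2)).
apply: (@inj_sub_card_le _ _ _ _ F); last first.
  move=> _ [[k n] [/= Kk _] <-].
  have [/EK [_ +] _] := hP _ Kk; apply.
  by exists (pickle (n, (h k).2)).
move=> -[k n] [k' n'].
rewrite !inE => -[/= Kk _] [/= Kk' _]; rewrite /F /= => eF.
have [[Ek _] [Ek' _]] := (hP _ Kk, hP _ Kk').
have h1 : (h k).1 = (h k').1.
  apply: tE => //; exists (F (k, n)); split.
    by exists (pickle (n, (h k).2)).
  by rewrite /F /= eF; exists (pickle (n', (h k').2)).
move: eF; rewrite -h1 => /(proj1 (EK _ Ek)) /(pcan_inj pickleK) [-> h2].
rewrite (hinj k k') //; move: h1 h2; case: (h k) (h k') => [a b] [c d] /=.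
by move=> -> ->.
Qed.

(** A point of the union is coded by a chosen [s] with [F s x] and by its number in [F s], that is,
    by an element of [K * nat]. *)
Lemma card_bigcup_countable_le (S T U : Type) (K : set T) (C : set S)
    (F : S -> set U) : infinite_set K -> C #<= K ->
  (forall s, C s -> countable (F s)) -> \bigcup_(s in C) F s #<= K.
Proof.
move=> Kinf CK cF; apply: card_le_trans (card_setX_nat_le Kinf).
elim/Ppointed: T => T in K Kinf CK *.
  by have [k] := infinite_setN0 Kinf; have [] := no k.
elim/Ppointed: S => S in C F CK cF *.
  rewrite (_ : \bigcup_(s in C) F s = set0) ?card_ge0// -subset0.
  by move=> x [s]; have [] := no s.
have [i] := pcard_leP CK.
have /choice[s sP] x : exists s, (\bigcup_(s in C) F s) x -> C s /\ F s x.
  have [[s Cs Fx]|//] := pselect ((\bigcup_(s in C) F s) x); first by exists s.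
  by exists point.
have /choice[g gP] s0 : exists g : U -> nat, C s0 -> {in F s0 &, injective g}.
  have [/cF/countable_injP[g ?]|//] := pselect (C s0); first by exists g.
  by exists (fun=> 0%N).
pose G x := (i (s x), g (s x) x).
apply: (@inj_sub_card_le _ _ _ _ G); last first.
  move=> _ [x /sP [Cs _] <-]; split => //=.
  exact: funS.
move=> x y; rewrite !inE => /sP[Cx Fx] /sP[Cy Fy] [ixy].
have sxy : s x = s y by apply: (@inj _ _ _ i) ixy; rewrite inE.
by rewrite -sxy; apply: gP; rewrite ?inE // sxy.
Qed.

(** * Polynomial roots, rational functions and generic reals *)

Lemma countable_roots (R : idomainType) (p : {poly R}) :
  countable [set x | p != 0 /\ root p x].
Proof.
have [->|p0] := eqVneq p 0.
  by rewrite (_ : [set x | _] = set0) ?countable0// -subset0 => x [].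
apply: finite_set_countable; apply: contrapT => /(infinite_set_fset (size p)).
move=> [B Bp]; apply/negP; rewrite -ltnNge; apply: max_poly_roots => //.
  by apply/allP => x /Bp [].
exact: finmap.fset_uniq.
Qed.

(** Reals enter only through the indices of [Par], which keeps the type countable. *)
Inductive rexpr := Var | Par of nat | Bin of arith & rexpr & rexpr.

Definition arith_code o :=
  match o with Add => 0 | Sub => 1 | Mul => 2 | Div => 3 end%N.

Fixpoint rexpr_code e : GenTree.tree nat := match e with
  | Var => GenTree.Leaf 0%N
  | Par n => GenTree.Leaf n.+1
  | Bin o a b => GenTree.Node (arith_code o) [:: rexpr_code a; rexpr_code b]
  end.

Lemma rexpr_code_inj : injective rexpr_code.
Proof.
elim=> [|n|o a iha b ihb] [|m|o' a' b'] //= [] => [->//|].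
by move=> oo' /iha -> /ihb ->; congr Bin; case: o o' oo' => -[].
Qed.

Lemma countable_rexpr (D : set rexpr) : countable D.
Proof.
apply/countable_injP; exists (pickle \o rexpr_code) => a b _ _ /=.
by move=> /(pcan_inj pickleK) /rexpr_code_inj.
Qed.

Section Generic.
Variables (R : realType) (par : nat -> R).
Implicit Types (e a b : rexpr) (x z : R) (C : set (seq R)).

(** In the [Div] case the denominator [q * r] does not record that [s] is nonzero; hence the lemmas
    on [arith_eval] assume nonvanishing for both operands separately. *)
Fixpoint frac_of e : {poly R} * {poly R} := match e with
  | Var => ('X, 1)
  | Par n => ((par n)%:P, 1)
  | Bin o a b =>
      let: (p, q) := frac_of a in let: (r, s) := frac_of b in
      match o with
      | Add => (p * s + r * q, q * s)
      | Sub => (p * s - r * q, q * s)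
      | Mul => (p * r, q * s)
      | Div => (p * s, q * r)
      end
  end.

Definition val_of e x := (frac_of e).1.[x] / (frac_of e).2.[x].

Lemma arith_eval_frac o a b x v :
  (frac_of a).2.[x] != 0 -> (frac_of b).2.[x] != 0 ->
  arith_eval o (val_of a x) (val_of b x) = Some v ->
  (frac_of (Bin o a b)).2.[x] != 0.
Proof.
rewrite /val_of /=; case: (frac_of a) (frac_of b) => p q [r s] /= q0 s0.
case: o => /=; rewrite hornerM => h; rewrite mulf_neq0//.
by move: h; case: ifPn => //; rewrite mulf_eq0 negb_or => /andP[].
Qed.

Lemma arith_eval_val o a b x :
  (frac_of a).2.[x] != 0 -> (frac_of b).2.[x] != 0 ->
  (frac_of (Bin o a b)).2.[x] != 0 ->
  arith_eval o (val_of a x) (val_of b x) = Some (val_of (Bin o a b) x).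
Proof.
rewrite /val_of /=; case: (frac_of a) (frac_of b) => p q [r s] /= q0 s0.
case: o => /=; rewrite ?(hornerD, hornerN, hornerM) => qs0; last first.
  have r0 : r.[x] != 0 by move: qs0; rewrite mulf_eq0 negb_or => /andP[].
  by rewrite mulf_eq0 invr_eq0 (negPf r0) (negPf s0) /=; congr Some; field;
    rewrite ?q0 ?r0 ?s0.
all: by congr Some; field; rewrite ?q0 ?r0 ?s0.
Qed.

Lemma continuous_val e x :
  (frac_of e).2.[x] != 0 -> {for x, continuous (val_of e)}.
Proof.
move=> ex; apply: cvgM; first exact: continuous_horner.
by apply: cvgV => //; exact: continuous_horner.
Qed.

(* [s`_i] also covers [0], by taking [i] beyond the end of [s] *)
Definition generic_for C x := forall e, (frac_of e).2 != 0 ->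
  (frac_of e).2.[x] != 0 /\
  forall s i, C s -> (frac_of e).1.[x] = s`_i * (frac_of e).2.[x] ->
    (frac_of e).1 = s`_i *: (frac_of e).2.

Lemma card_nongeneric_le T (K : set T) C : C !=set0 ->
  infinite_set K -> C #<= K -> ~` generic_for C #<= K.
Proof.
move=> [s0 Cs0] Kinf CK.
(* The boolean puts the denominators in the list of every tuple; [s0] ensures that there is such a
   list. *)
pose pol s e i (t : bool) :=
  if t then (frac_of e).2 else (frac_of e).1 - s`_i *: (frac_of e).2.
pose F s :=
  \bigcup_e \bigcup_i \bigcup_t
    [set x | pol s e i t != 0 /\ root (pol s e i t) x].
have cF s : countable (F s).
  apply: bigcup_countable => [|e _]; first exact: countable_rexpr.
  apply: bigcup_countable => [|i _]; first exact: countableP.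
  apply: bigcup_countable => [|t _]; first exact: countableP.
  exact: countable_roots.
apply: card_le_trans (card_bigcup_countable_le Kinf CK (fun s _ => cF s)).
apply: subset_card_le => x; apply: contra_notP => xF e e0.
have nF s i t : C s -> pol s e i t != 0 -> (pol s e i t).[x] != 0.
  move=> Cs p0; apply/negP => px; apply: xF.
  by exists s => //; exists e => //; exists i => //; exists t.
split; first exact: (nF s0 0%N true).
move=> s i Cs ex; apply/eqP; rewrite -subr_eq0.
by apply: contraT => /(nF s i false Cs); rewrite /pol !hornerE ex subrr eqxx.
Qed.

Lemma generic_val_const C x z e s i :
  generic_for C x -> generic_for C z -> C s -> (frac_of e).2 != 0 ->
  val_of e x = s`_i -> val_of e z = s`_i.
Proof.
move=> gx gz Cs e0 ex; have [dx constx] := gx e e0; have [dz _] := gz e e0.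
by rewrite /val_of (constx s i Cs) ?hornerZ ?mulfK// -ex divfK.
Qed.

End Generic.

(** * Uniqueness of the tuple on a tape *)

Section TapeTuple.
Variables (R : realType) (t : tape R).

Lemma tape_tuple_size_le y y' :
  tape_tuple t y -> tape_tuple t y' -> (size y' <= size y)%N.
Proof.
move=> ty ty'; rewrite leqNgt; apply/negP => szy.
(* Cell [size y] is blank by [ty], but a longer [y'] would fill it. *)
have := ty _ (leqnn _).
rewrite (ty' _ (ltnW szy)) (onth_default (leqnn _)) => yN.
by have := onthTE y' (size y); rewrite szy yN.
Qed.

Lemma tape_tuple_inj y y' : tape_tuple t y -> tape_tuple t y' -> y = y'.
Proof.
move=> ty ty'; apply: eq_from_onth_le => i szi.
have sz : size y = size y'.
  by apply/eqP; rewrite eqn_leq !tape_tuple_size_le.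
have iy : (i <= size y)%N by rewrite ltnW// -(maxnn (size y)) {2}sz.
by rewrite -ty// ty' -?sz.
Qed.

End TapeTuple.

(** * Symbolic runs near a generic input *)

Section Run.
Variables (R : realType) (P : program R) (C A : set (seq R)).
Hypothesis C0 : C !=set0.
Hypothesis AC : A = C \/ A = ~` C.
Implicit Types (x z : R).

(* The constant of a [Const] instruction is named by the position of the
   instruction in the program. *)
Definition program_par n : R := if onth P n is Some (Const _ a) then a else 0.

Local Notation val := (val_of program_par).
Local Notation frac := (frac_of program_par).
Local Notation generic := (generic_for program_par C).

Definition eval_tape (st : int -> option rexpr) x : tape R :=
  fun i => omap (val^~ x) (st i).

(** Asked of the polynomials and not at a point, so that it serves all generic inputs at once. *)
Definition defined_tape (st : int -> option rexpr) :=
  forall i e, st i = Some e -> (frac e).2 != 0.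

Lemma tape_tuple_generic x z st y : generic x -> generic z -> defined_tape st ->
  C y -> tape_tuple (eval_tape st x) y -> tape_tuple (eval_tape st z) y.
Proof.
move=> gx gz dst Cy ty i /ty; rewrite /eval_tape.
case e : (st i) => [a|] //= /esym ya; rewrite ya; congr Some.
have {}ya := esym (onth_nth 0 _ _ _ ya).
by rewrite ya; apply: (generic_val_const gx gz Cy (dst _ _ e) ya).
Qed.

(** Which cells are blank depends on [st] alone, not on the input. *)
Lemma ex_tape_tuple x z st y : tape_tuple (eval_tape st x) y ->
  exists y', tape_tuple (eval_tape st z) y'.
Proof.
pose f i := odflt 0 (eval_tape st z (Posz i)).
move=> ty; exists (mkseq f (size y)) => i; rewrite /f.
rewrite size_mkseq => iy; have := ty i iy; rewrite /mkseq onth_map.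
move: iy; rewrite leq_eqVlt => /orP[/eqP ->|iy].
  rewrite !onth_default ?size_iota// /eval_tape.
  by case: (st _).
rewrite [onth (iota _ _) i](_ : _ = Some i); last first.
  by rewrite onthE (nth_map 0%N) ?size_iota// nth_iota.
have : onth y i by rewrite onthTE.
by rewrite /eval_tape /=; case: (st i) => //=; case: (onth y i).
Qed.

Lemma oracle_generic x z st : generic x -> generic z -> defined_tape st ->
  (exists2 y, tape_tuple (eval_tape st x) y & A y) ->
  exists2 y, tape_tuple (eval_tape st z) y & A y.
Proof.
move=> gx gz dst [y ty]; case: AC => -> Cy.
  by exists y => //; exact: tape_tuple_generic ty.
(* If the tuple at [z] were in [C], genericity would carry it back to [x], where it would be [y]. *)
have [y' ty'] := ex_tape_tuple z ty; exists y' => // Cy'; apply: Cy.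
by rewrite (tape_tuple_inj ty (tape_tuple_generic gz gx dst Cy' ty')).
Qed.

Definition write_expr (st : int -> option rexpr) k e := fun i : int =>
  if i == k then e else st i.

Lemma eval_write_expr st k e x :
  eval_tape (write_expr st k e) x = write (eval_tape st x) k (omap (val^~ x) e).
Proof.
by apply/funext => i; rewrite /eval_tape /write_expr /write; case: eqP.
Qed.

Lemma defined_write_expr st k e : defined_tape st ->
  (forall a, e = Some a -> (frac a).2 != 0) -> defined_tape (write_expr st k e).
Proof.
move=> dst de i a; rewrite /write_expr.
by case: eqP => _; [apply: de|apply: dst].
Qed.

(** A neighbourhood is needed only for sign tests of a nonzero value; every other step acts alike on
    all generic inputs. *)
Lemma step_near x st pc pc' t' : generic x -> defined_tape st ->
  step P A (pc, eval_tape st x) = Some (pc', t') ->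
  exists2 st', defined_tape st' &
    \forall y \near x, generic y ->
      step P A (pc, eval_tape st y) = Some (pc', eval_tape st' y).
Proof.
move=> gx dst; rewrite /step /=; case Ppc : (onth P pc) => [ins|//].
case: ins Ppc => [k a|o k i j|k i|k|k|k l0 lneg lpos|k l1 l2|l1 l2] Ppc /=.
- move=> [<- _]; exists (write_expr st k (Some (Par pc))).
    by apply: defined_write_expr => // _ [<-] /=; exact: oner_neq0.
  apply: filterE => y _; rewrite eval_write_expr /= /val_of /=.
  by rewrite /program_par Ppc !hornerE divr1.
- rewrite {1 2}/eval_tape; case ei : (st i) => [a|//].
  case ej : (st j) => [b|//] /=.
  have [da _] := gx _ (dst _ _ ei); have [db _] := gx _ (dst _ _ ej).
  case eo : arith_eval => [v|//] [<- _].
  (* The operation succeeded at [x], so the new denominator is a nonzero polynomial and vanishes at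
     no generic [y]. *)
  have dx := arith_eval_frac da db eo.
  have d0 : (frac (Bin o a b)).2 != 0.
    by apply: contraNneq dx => ->; rewrite horner0.
  exists (write_expr st k (Some (Bin o a b))).
    by apply: defined_write_expr => // _ [<-].
  apply: filterE => y gy.
  rewrite eval_write_expr /eval_tape ei ej /= -/(eval_tape st y).
  have [day _] := gy _ (dst _ _ ei); have [dby _] := gy _ (dst _ _ ej).
  by have [dy _] := gy _ d0; rewrite arith_eval_val.
- move=> [<- _]; exists (write_expr st k (st i)).
    by apply: defined_write_expr => // a; exact: dst.
  by apply: filterE => y _; rewrite eval_write_expr.
- move=> [<- _]; exists (write_expr st k None).
    exact: defined_write_expr.
  by apply: filterE => y _; rewrite eval_write_expr.
- move=> [<- _]; exists (fun i => st (i + k)) => [i|]; first exact: dst.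
  exact: filterE.
- rewrite {1}/eval_tape; case ek : (st k) => [a|//] /= [<- _]; exists st => //.
  have [da _] := gx _ (dst _ _ ek).
  have ca : val a z @[z --> x] --> val a x := continuous_val da.
  have [ax0|ax0|ax0] := ltgtP (val a x) 0.
  + have near_a : \forall y \near x, val a y < 0 by exact: cvgr_lt ca _ ax0.
    apply: filterS near_a => y ay _.
    by rewrite /eval_tape ek /= ay (lt_eqF ay).
  + have near_a : \forall y \near x, val a y > 0 by exact: cvgr_gt ca _ ax0.
    apply: filterS near_a => y ay _.
    by rewrite /eval_tape ek /= (lt_gtF ay) (gt_eqF ay).
  + apply: filterE => y gy; rewrite /eval_tape ek /=.
    (* Zero is the default entry just past the end of [s], so a value that is zero at [x] is zero at
       every generic input. *)
    have [s Cs] := C0; have a0 u : val a u = s`_(size s) <-> val a u = 0.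
      by rewrite nth_default.
    rewrite (iffLR (a0 y)) ?eqxx//.
    by apply: generic_val_const gx gy Cs _ _; [exact: dst ek|exact/a0].
- move=> [<- _]; exists st => //; apply: filterE => y _.
  by rewrite /eval_tape; case: (st k).
- move=> [<- _]; exists st => //; apply: filterE => y gy; congr (Some (_, _)).
  congr (if _ then _ else _); apply: asbool_equiv_eq; split.
    exact: oracle_generic gy gx dst.
  exact: oracle_generic gx gy dst.
Qed.

Lemma runS n c : run P A n.+1 c = obind (step P A) (run P A n c).
Proof. by []. Qed.

Lemma run_near x n pc t : generic x ->
  run P A n (0%N, input_tape [:: x]) = Some (pc, t) ->
  exists2 st, defined_tape st &
    \forall y \near x, generic y ->
      run P A n (0%N, input_tape [:: y]) = Some (pc, eval_tape st y).
Proof.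
move=> gx; elim: n pc t => [|n IHn] pc t.
  move=> [<- _]; exists (fun i => if i == 0 then Some Var else None).
    by move=> i e; case: eqP => // _ [<-] /=; exact: oner_neq0.
  apply: filterE => y _; congr (Some (_, _)); apply/funext => -[[|i]|i] //=.
    by rewrite /eval_tape /= /val_of /= !hornerE divr1.
  by rewrite onth0n.
rewrite runS; case e : run => [[pc1 t1]|//] /= st1.
have [st dst near_st] := IHn _ _ e.
(* The point [x] lies in its own neighbourhoods, so the actual tape is the symbolic one evaluated at
   [x]. *)
have t1E : t1 = eval_tape st x.
  by move: (nbhs_singleton near_st gx); rewrite e => -[].
rewrite t1E in st1; have [st' dst' near_st'] := step_near gx dst st1.
exists st' => //; apply: filterS2 near_st near_st' => y sty sty' gy.
by rewrite sty //= sty'.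
Qed.

(** Yields uniqueness of the halting time: no instruction is left to execute, and failure
    persists. *)
Lemma run_halted n m c c' : run P A n c = Some c' -> (size P <= c'.1)%N ->
  (n < m)%N -> run P A m c = None.
Proof.
move=> rn halt /subnK <-; elim: (m - n.+1)%N => [|k IHk]; last first.
  by rewrite addSn runS IHk.
by rewrite add0n runS rn /= /step onth_default.
Qed.

(** Nearby generic inputs share the instruction counter with [x], hence the halting time, and their
    output is the same fraction [e], read in cell 0. *)
Lemma outputs_near x v : generic x -> outputs P A [:: x] [:: v] ->
  exists e, [/\ val e z @[z --> x] --> val e x, val e x = v &
    \forall y \near x, generic y -> forall w, outputs P A [:: y] [:: w] ->
      val e y = w].
Proof.
move=> gx [n [pc [t [rn halt tv]]]].
have [st dst near_st] := run_near gx rn.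
have t0 : t = eval_tape st x.
  by move: (nbhs_singleton near_st gx); rewrite rn => -[].
have := tv 0%N isT; rewrite t0 /eval_tape /=; case e0 : (st 0) => [e|//] [ev].
exists e; split=> //.
  by apply: continuous_val; have [] := gx _ (dst _ _ e0).
apply: filterS near_st => y /[apply] rny w [n' [pc' [t' [rn' halt' tw]]]].
have nn' : n = n'.
  have [nn'|n'n|//] := ltngtP n n'.
    by rewrite (run_halted rny halt nn') in rn'.
  by rewrite (run_halted rn' halt' n'n) in rny.
move: rn'; rewrite -nn' rny => -[_ t'E].
by have := tw 0%N isT; rewrite -t'E /eval_tape e0 => -[].
Qed.

(** * Local constancy of [S] and the conclusion *)

Lemma locally_bicard_le_of_reduction T (K : set T) (S : set R) :
  infinite_set K -> C #<= K ->
  (forall s, outputs P A s [:: \1_(tuples1 S) s]) -> locally_bicard_le K S.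
Proof.
move=> Kinf CK PS; set N := ~` generic.
have NK : N #<= K by exact: card_nongeneric_le.
have tuples1E x : tuples1 S [:: x] = S x.
  by apply/propext; split=> [[y Sy [<-]]|Sx] //; exists x.
exists (~` S `|` N)°, (S `|` N)°; split; first exact: open_interior.
split; first exact: open_interior.
have sub_le B : B `<=` N -> B #<= K.
  by move=> /subset_card_le /card_le_trans; apply.
split; last first.
  split; apply: sub_le => x [].
    by move=> /interior_subset [].
  by move=> /interior_subset [].
(* Near a generic [x] the indicator of [S] agrees on generic reals with a fraction continuous at
   [x]; comparison with 1/2 shows that it keeps its value there. *)
apply: sub_le => x; apply: contra_notP => /contrapT gx.
have [e [ce ex near_e]] := outputs_near gx (PS [:: x]).
have out y : \1_(tuples1 S) [:: y] = (`[< S y >])%:R :> R.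
  by rewrite indicE -tuples1E.
have [Sx|nSx] := pselect (S x).
  right.
  have ex1 : 1 / 2 < val e x by rewrite ex out asboolT//=; lra.
  have near_half : \forall y \near x, 1 / 2 < val e y.
    exact: cvgr_gt ce _ ex1.
  apply: filterS2 near_e near_half => y ey ey1.
  have [gy|] := pselect (generic y); last by right.
  left; move: ey1; rewrite (ey gy _ (PS _)) out.
  by case: asboolP => //= _; lra.
left.
have ex1 : val e x < 1 / 2 by rewrite ex out asboolF//=; lra.
have near_half : \forall y \near x, val e y < 1 / 2.
  exact: cvgr_lt ce _ ex1.
apply: filterS2 near_e near_half => y ey ey1.
have [gy|] := pselect (generic y); last by right.
left; move: ey1; rewrite (ey gy _ (PS _)) out.
by case: asboolP => //= _; lra.
Qed.

End Run.

Theorem theorem6p4 (R : realType) (T : Type) (K : set T)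
    (Kinf : infinite_set K)
    (Kle : K #<= [set: nat -> bool]) (Kneq : K #!= [set: nat -> bool]) :
  (forall (C : set (seq R)) (S : set R),
      C #= K -> bss_reducible (tuples1 S) C -> locally_bicard_le K S) /\
  (forall (C : set (seq R)) (S : set R),
      ~` C #= K -> bss_reducible (tuples1 S) C -> locally_bicard_le K S).
Proof.
have CK_le (C : set (seq R)) : C #= K -> C !=set0 /\ C #<= K.
  move=> CK; split; last by move: CK; rewrite card_eq_le => /andP[].
  by apply: infinite_setN0; rewrite (eq_finite_set CK).
split=> C S /CK_le[C0 CK] [P PS].
  exact: (locally_bicard_le_of_reduction C0 (or_introl erefl) Kinf CK PS).
(* Here the small set is the complement of the oracle. *)
apply: (locally_bicard_le_of_reduction C0 _ Kinf CK PS).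
by right; rewrite setCK.
Qed.
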